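(* For every $D>0$ there is a constant $K$ such that the following holds. Let $k=k(n)$ be a positive integer with $k<D\log n$ and $k\mid n$, let $m=n/k$, and let $v_1,\dots,v_m$ be $m$ given distinct vertices of $[n]$. Then, with probability tending to $1$ as $n\to\infty$, the random graph $\mathcal{G}(n,K\frac{\log n}{n})$ contains $m$ pairwise vertex-disjoint paths, each on exactly $k$ vertices, such that for each $i\in[m]$ the $i$-th path has $v_i$ as an endpoint.
   Context: $\mathcal{G}(n,p)$ denotes the binomial random graph on vertex set $[n]=\{1,\dots,n\}$ in which each possible edge is present independently with probability $p$. $\log$ denotes the natural logarithm. *)

(* Defs.v *)
From HB Require Import structures.
From mathcomp Require Import all_boot all_order all_algebra.
From mathcomp Require Import all_classical all_reals all_analysis.
Set Implicit Arguments. Unset Strict Implicit. Unset Printing Implicit Defensive.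
Import Order.TTheory GRing.Theory Num.Theory.
Local Open Scope ring_scope.

Definition is_graph (n : nat) (E : {set {set 'I_n}}) : bool :=
  [forall e in E, #|e| == 2%N].

Definition adj (n : nat) (E : {set {set 'I_n}}) (x y : 'I_n) : bool :=
  [set x; y] \in E.

(* Probability, in G(n,p), that the graph satisfies the property P:
   each of the 'C(n,2) possible edges is present independently with prob. p. *)
Definition Gnp_prob (R : realType) (n : nat) (p : R)
    (P : {set {set 'I_n}} -> bool) : R :=
  \sum_(E : {set {set 'I_n}} | is_graph E && P E)
     p ^+ #|E| * (1 - p) ^+ ('C(n, 2) - #|E|).

Definition is_graph_path (n : nat) (E : {set {set 'I_n}}) (s : seq 'I_n) : bool :=
  uniq s && match s with [::] => false | x :: s' => path (adj E) x s' end.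

Definition is_endpoint (n : nat) (v : 'I_n) (s : seq 'I_n) : bool :=
  (ohead s == Some v) || (ohead (rev s) == Some v).

Definition has_path_cover (n k m : nat) (vs : 'I_m -> 'I_n)
    (E : {set {set 'I_n}}) : Prop :=
  exists P : 'I_m -> seq 'I_n,
    (forall i, is_graph_path E (P i) /\ size (P i) = k /\ is_endpoint (vs i) (P i)) /\
    (forall i j, i != j -> [disjoint P i & P j]).

Definition has_path_cover_b (n k m : nat) (vs : 'I_m -> 'I_n)
    (E : {set {set 'I_n}}) : bool :=
  `[< has_path_cover k vs E >].

(* Main.v *)
(** A uniformly random path system is obtained by filling a fixed layout of the
    [n] places into paths with a random permutation fixing the [v_i]. Its edge set
    is spread: it contains a given set of [s] edges with probability at most
    [q ^ s], where [q = 8 e / n] if [k >= 2]. Indeed, once the edges are oriented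
    (in [2 ^ s] ways), the places of the sources determine those of the targets.

    A spread family is met by a random set of density of order [q ln n], by the
    minimum-fragment form of the Kahn-Kalai argument. Expose the random set in
    about [log2 n] rounds of density [16 q]. After a round [W], the minimal sets
    among the [S :\: W] are either large, and then form a family of small expected
    cost [\sum q ^ #|T|], or are the next hypergraph, with sets half as large.
    When the sizes are bounded by a constant [m], one round of density [q ln n]
    ends the process with error [O (m / ln n)]. If the random set misses every
    path system, the large fragments collected on the way cover them all, so by
    the spread property they cost at least [1]. *)

Require Import Defs.
From HB Require Import structures.
From mathcomp Require Import all_boot all_order all_algebra all_fingroup.
From mathcomp Require Import all_classical all_reals all_analysis.
From mathcomp Require Import ring lra.
Import Order.TTheory GRing.Theory Num.Theory.
Import numFieldNormedType.Exports.
Local Open Scope ring_scope.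

(** * Random subsets with independent elements *)

Definition rset_prob {R : realType} {X : finType} (p : X -> R) (W : {set X}) : R :=
  \prod_x (if x \in W then p x else 1 - p x).

(** Density 0 outside [G] lets a random graph be a random set over the type of all vertex sets, with
    [G] the set of pairs. *)
Definition on_set {R : realType} {X : finType} (G : {set X}) (p : R) (x : X) : R :=
  if x \in G then p else 0.

Lemma on_set_ge0 {R : realType} {X : finType} (G : {set X}) (p : R) :
  0 <= p -> forall x, 0 <= on_set G p x.
Proof. by move=> p0 x; rewrite /on_set; case: ifP. Qed.

Lemma on_set_le1 {R : realType} {X : finType} (G : {set X}) (p : R) :
  p <= 1 -> forall x, on_set G p x <= 1.
Proof. by move=> p1 x; rewrite /on_set; case: ifP. Qed.

Lemma prod_if_const {R : realType} {X : finType} (A : {set X}) (c : R) :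
  \prod_x (if x \in A then c else 1) = c ^+ #|A|.
Proof. by rewrite -big_mkcond prodr_const. Qed.

Lemma sum_set_prod {R : realType} {X : finType} (a : X -> bool -> R) :
  \sum_(W : {set X}) \prod_x a x (x \in W) = \prod_x (a x true + a x false).
Proof.
rewrite bigA_distr; apply: eq_big => [W|W _]; first by rewrite inE.
by apply: eq_bigr => x _; case: (x \in W).
Qed.

Lemma rset_prob_ge0 {R : realType} {X : finType} (p : X -> R) (W : {set X}) :
  (forall x, 0 <= p x) -> (forall x, p x <= 1) -> 0 <= rset_prob p W.
Proof. by move=> p0 p1; apply: prodr_ge0 => x _; case: ifP; rewrite ?subr_ge0. Qed.

Lemma sum_rset_prob {R : realType} {X : finType} (p : X -> R) :
  \sum_W rset_prob p W = 1.
Proof.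
rewrite (sum_set_prod (fun x (b : bool) => if b then p x else 1 - p x)).
by rewrite big1 // => x _; rewrite addrC subrK.
Qed.

(** The event that the union is a given [W] factorises over the elements, so the double sum becomes
    a product of one-element sums. This splits one exposure into two independent rounds. *)
Lemma sum_rset_prob_setU {R : realType} {X : finType} (p1 p2 : X -> R)
    (f : {set X} -> R) :
  \sum_W rset_prob (fun x => 1 - (1 - p1 x) * (1 - p2 x)) W * f W =
  \sum_W1 \sum_W2 rset_prob p1 W1 * rset_prob p2 W2 * f (W1 :|: W2).
Proof.
transitivity (\sum_W1 \sum_W2 \sum_W rset_prob p1 W1 * rset_prob p2 W2 *
    (W == W1 :|: W2)%:R * f W); last first.
  apply: eq_bigr => W1 _; apply: eq_bigr => W2 _.
  rewrite (bigD1 (W1 :|: W2)) //= eqxx mulr1 big1 ?addr0 // => W /negPf ->.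
  by rewrite mulr0 mul0r.
symmetry; under eq_bigr => W1 _ do rewrite exchange_big.
rewrite exchange_big; apply: eq_bigr => W _ /=.
under eq_bigr => W1 _ do rewrite -mulr_suml.
rewrite -mulr_suml; congr (_ * _).
pose a x b1 b2 : R := (if b1 then p1 x else 1 - p1 x) *
  (if b2 then p2 x else 1 - p2 x) * ((x \in W) == (b1 || b2))%:R.
transitivity (\sum_(W1 : {set X}) \sum_(W2 : {set X}) \prod_x a x (x \in W1) (x \in W2)).
  apply: eq_bigr => W1 _; apply: eq_bigr => W2 _.
  rewrite !big_split /=; congr (_ * _).
  have [->|neqW] := eqVneq W (W1 :|: W2).
    by rewrite big1 // => x _; rewrite inE eqxx.
  have [x neqx] : exists x, (x \in W) != ((x \in W1) || (x \in W2)).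
    apply/existsP; apply: contraR neqW => /existsPn eqW.
    by apply/eqP/setP => x; rewrite inE; have /negPn/eqP := eqW x.
  by rewrite (bigD1 x) //= (negPf neqx) mul0r.
under eq_bigr => W1 _ do rewrite (sum_set_prod (fun x => a x (x \in W1))).
rewrite (sum_set_prod (fun x b => a x b true + a x b false)).
apply: eq_bigr => x _; rewrite /a; case: (x \in W) => /=;
  rewrite ?mulr0 ?mulr1; ring.
Qed.

Lemma sum_subset_pow {R : realType} {X : finType} (z : R) (S : {set X}) :
  \sum_(T : {set X} | T \subset S) z ^+ #|T| = (1 + z) ^+ #|S|.
Proof.
pose a x (b : bool) : R := if b then (if x \in S then z else 0) else 1.
rewrite -prod_if_const.
transitivity (\prod_x (a x true + a x false)); last first.
  by apply: eq_bigr => x _; rewrite /a; case: ifP; rewrite ?add0r // addrC.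
rewrite -sum_set_prod big_mkcond; apply: eq_bigr => T _.
case: ifPn => [sTS|/subsetPn[x xT xS]].
  rewrite -prod_if_const; apply: eq_bigr => x _; rewrite /a.
  by case: ifP => // xT; rewrite (fintype.subsetP sTS).
by rewrite (bigD1 x) //= /a xT (negPf xS) mul0r.
Qed.

(** Writing [x] as [(x / z) * z], each large [T] gains the factor [(x / z) ^+ k.+1], and a binomial
    sum remains. The parameter [z] stays free: it will be [m%:R^-1] in the last round and 1 in the
    others. *)
Lemma sum_large_subset_pow_le {R : realType} {X : finType} (x z : R)
    (S : {set X}) (k l : nat) : 0 <= x -> x <= z -> 0 < z -> (#|S| <= l)%N ->
  \sum_(T : {set X} | (T \subset S) && (k < #|T|)%N) x ^+ #|T|
    <= (x / z) ^+ k.+1 * (1 + z) ^+ l.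
Proof.
move=> x0 xz z0 Sl.
have xz0 : 0 <= x / z by rewrite divr_ge0 // ltW.
have xz1 : x / z <= 1 by rewrite ler_pdivrMr // mul1r.
apply: (@le_trans _ _ (\sum_(T : {set X} | T \subset S) (x / z) ^+ k.+1 * z ^+ #|T|)).
  rewrite big_mkcondr /=; apply: ler_sum => T sTS; case: ifP => kT; last first.
    by rewrite mulr_ge0 // exprn_ge0 // ltW.
  rewrite -[in leLHS](divfK (lt0r_neq0 z0) x) exprMn ler_wpM2r //.
    by rewrite exprn_ge0 // ltW.
  by rewrite ler_wiXn2l.
rewrite -mulr_sumr sum_subset_pow ler_wpM2l ?exprn_ge0 //.
by rewrite ler_weXn2l // lerDl ltW.
Qed.

(** * Covers, minimal fragments and their expected cost *)

Definition covers {X : finType} (U H : {set {set X}}) : bool :=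
  [forall S in H, [exists T in U, T \subset S]].

Definition misses {X : finType} (H : {set {set X}}) (W : {set X}) : bool :=
  [forall S in H, ~~ (S \subset W)].

(** For [0 <= q <= 1], the expected number of members of [U] inside a random set of density [q]. *)
Definition cost {R : realType} {X : finType} (q : R) (U : {set {set X}}) : R :=
  \sum_(T in U) q ^+ #|T|.

Definition miss_prob {R : realType} {X : finType} (p : X -> R)
    (H : {set {set X}}) : R :=
  \sum_W rset_prob p W * (misses H W)%:R.

Definition fragments {X : finType} (H : {set {set X}}) (W : {set X}) :
    {set {set X}} :=
  [set T | minset (fun T => T \in [set S :\: W | S in H]) T].

Lemma fragmentsP {X : finType} (H : {set {set X}}) (W T : {set X}) :
  T \in fragments H W -> exists2 S, S \in H & T = S :\: W.
Proof. by rewrite inE => /minsetP[/imsetP[S HS ->] _]; exists S. Qed.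

Lemma exists_fragment {X : finType} (H : {set {set X}}) (W S : {set X}) :
  S \in H -> exists2 T, T \in fragments H W & T \subset S.
Proof.
move=> HS; have [|T minT sT] :=
    @minset_exists _ (fun T => T \in [set S :\: W | S in H]) (S :\: W).
  by apply/imsetP; exists S.
by exists T; rewrite ?inE //; apply: fintype.subset_trans sT (subsetDl _ _).
Qed.

(* Any member of [H] inside [W :|: T] leaves, once [W] is removed, a subset of
   the minimal set [T], hence [T] itself. *)
Lemma fragment_sub {X : finType} (H : {set {set X}}) (W T S : {set X}) :
  T \in fragments H W -> S \in H -> S \subset W :|: T -> T \subset S.
Proof.
rewrite inE => /minsetP[_ minT] HS sSWT; rewrite -(minT (S :\: W)).
- exact: subsetDl.
- by apply/imsetP; exists S.
- by rewrite subDset.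
Qed.

Lemma misses_fragments {X : finType} (H : {set {set X}}) (W1 W2 : {set X})
    (F : {set {set X}}) :
  F \subset fragments H W1 -> misses H (W1 :|: W2) -> misses F W2.
Proof.
move=> sF /forall_inP mH; apply/forall_inP => T FT.
have [S HS defT] := fragmentsP _ _ _ (fintype.subsetP sF T FT).
apply: contra (mH S HS); rewrite defT => sTW2.
by rewrite -subDset.
Qed.

(** Only the elements of [T] change their factor: [(1 - p) * p] on the left against [p] on the
    right. *)
Lemma rset_prob_setU {R : realType} {X : finType} (G : {set X}) (p : R)
    (W T : {set X}) : 0 <= p <= 1 -> T \subset G -> [disjoint W & T] ->
  rset_prob (on_set G p) W * p ^+ #|T| <= rset_prob (on_set G p) (W :|: T).
Proof.
move=> /andP[p0 p1] sTG dWT.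
rewrite -prod_if_const -big_split /=; apply: ler_prod => x _; rewrite inE.
have [xW|xW] := boolP (x \in W) => /=.
  rewrite (disjointFr dWT xW) mulr1 lexx andbT; exact: on_set_ge0.
have [xT|xT] := boolP (x \in T); last first.
  rewrite mulr1 lexx andbT subr_ge0; exact: on_set_le1.
by rewrite /on_set (fintype.subsetP sTG x xT) mulr_ge0 ?subr_ge0 //= ler_piMl // lerBlDr lerDl.
Qed.

(** The pairs [(W, T)] are counted through [Z = W :|: T]: the weight of [W] times [q ^+ #|T|] is at
    most the weight of [Z] times [(q / p) ^+ #|T|]. By minimality [T] lies in every member of [H]
    inside [Z], so given [Z] it ranges over subsets of one set of size at most [l]. *)
Lemma sum_cost_fragments_le {R : realType} {X : finType} (q p z : R)
    (G : {set X}) (H : {set {set X}}) (k l : nat) :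
  0 <= q -> 0 < p <= 1 -> q / p <= z -> 0 < z ->
  (forall S, S \in H -> S \subset G /\ (#|S| <= l)%N) ->
  \sum_W rset_prob (on_set G p) W *
      cost q [set T in fragments H W | (k < #|T|)%N]
    <= (q / p / z) ^+ k.+1 * (1 + z) ^+ l.
Proof.
move=> q0 /andP[p0 p1] qpz z0 HP.
have x0 : 0 <= q / p by rewrite divr_ge0 // ltW.
have mu0 W : 0 <= rset_prob (on_set G p) W.
  apply: rset_prob_ge0; first exact/on_set_ge0/ltW.
  exact: on_set_le1.
(* The choice depends on the union [Z] alone. The default, the empty set, respects the size bound
   [l] too. *)
pose sel (Z : {set X}) := odflt finset.set0 [pick S in H | S \subset Z].
have sel_le Z : (#|sel Z| <= l)%N.
  rewrite /sel; case: pickP => [S /andP[/HP[]]//|_] /=; by rewrite cards0.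
set B := (X in _ <= X).
apply: (@le_trans _ _ (\sum_(Z : {set X}) \sum_(T : {set X} | (T \subset sel Z) && (k < #|T|)%N)
    rset_prob (on_set G p) Z * (q / p) ^+ #|T|)); last first.
  apply: (@le_trans _ _ (\sum_(Z : {set X}) rset_prob (on_set G p) Z * B)).
    apply: ler_sum => Z _; rewrite -mulr_sumr ler_wpM2l //.
    exact: sum_large_subset_pow_le.
  by rewrite -mulr_suml sum_rset_prob mul1r.
apply: (@le_trans _ _ (\sum_(W : {set X}) \sum_(T : {set X} |
    [&& [disjoint W & T], T \subset sel (W :|: T) & (k < #|T|)%N])
    rset_prob (on_set G p) (W :|: T) * (q / p) ^+ #|T|)).
  apply: ler_sum => W _; rewrite /cost mulr_sumr [leRHS]big_mkcond [leLHS]big_mkcond /=.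
  apply: ler_sum => T _; rewrite inE.
  case: ifPn => [/andP[fT kT]|_]; last by case: ifP => // _; rewrite mulr_ge0 ?exprn_ge0.
  have [S HS defT] := fragmentsP _ _ _ fT.
  have dWT : [disjoint W & T] by rewrite defT disjoint_sym finset.disjoints_subset finset.subsetDr.
  have sTG : T \subset G.
    rewrite defT; apply: fintype.subset_trans (subsetDl _ _) _; exact: (HP S HS).1.
  have sTsel : T \subset sel (W :|: T).
    rewrite /sel; case: pickP => [S' /andP[HS' sS']|/(_ S)] /=.
      exact: fragment_sub fT HS' sS'.
    by rewrite HS -subDset defT subxx.
  rewrite dWT sTsel kT /= -[in leLHS](divfK (lt0r_neq0 p0) q) exprMn.
  rewrite [_ * p ^+ _]mulrC mulrA ler_wpM2r ?exprn_ge0 //.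
  by apply: rset_prob_setU => //; rewrite ltW.
under eq_bigr => W _ do rewrite big_mkcond.
under [leRHS]eq_bigr => Z _ do rewrite big_mkcond.
rewrite exchange_big [leRHS]exchange_big /=; apply: ler_sum => T _.
rewrite -!big_mkcond /=.
(* For fixed [T], disjointness recovers [W] from [Z = W :|: T] as [Z :\: T]. *)
rewrite [leLHS](reindex_onto (fun Z => Z :\: T) (fun W => W :|: T)) /=; last first.
  move=> W /and3P[dWT _ _]; rewrite finset.setDUl finset.setDv finset.setU0.
  exact/finset.setDidPl.
rewrite [leLHS]big_mkcond [leRHS]big_mkcond /=; apply: ler_sum => Z _.
case: ifPn => [/andP[/and3P[_ sTsel kT] /eqP defZ]|_].
  by rewrite defZ in sTsel *; rewrite sTsel kT.
by case: ifP => // _; rewrite mulr_ge0 ?exprn_ge0.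
Qed.

(** * Iterated exposure *)

(* The invariant of the iteration, with [a] in the role of the least cost of a
   cover of [H]. *)
Definition miss_bound {R : realType} {X : finType} (q : R) (G : {set X})
    (l : nat) (P eps : R) : Prop :=
  forall p, P <= p <= 1 ->
  forall H : {set {set X}}, (forall S, S \in H -> S \subset G /\ (#|S| <= l)%N) ->
  forall a, 0 <= a -> (forall U, covers U H -> a <= cost q U) ->
  miss_prob (on_set G p) H * a <= eps.

Lemma cost_ge0 {R : realType} {X : finType} (q : R) (U : {set {set X}}) :
  0 <= q -> 0 <= cost q U.
Proof. by move=> q0; apply: sumr_ge0 => T _; rewrite exprn_ge0. Qed.

Lemma cost_setU {R : realType} {X : finType} (q : R) (U V : {set {set X}}) :
  0 <= q -> cost q (U :|: V) <= cost q U + cost q V.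
Proof.
move=> q0; rewrite /cost big_mkcond [in leRHS]big_mkcond [X in _ <= _ + X]big_mkcond.
rewrite -big_split /=; apply: ler_sum => T _; rewrite inE.
have := exprn_ge0 #|T| q0.
by case: (T \in U); case: (T \in V) => //= ?; rewrite ?addr0 ?add0r ?lerDl.
Qed.

(** If [H] is empty, the empty cover has cost 0 and forces [a = 0]; otherwise [H] contains the empty
    set, which no [W] misses. *)
Lemma miss_bound0 {R : realType} {X : finType} (q : R) (G : {set X}) (P : R) :
  miss_bound q G 0 P 0.
Proof.
move=> p _ H HP a a0 ha.
have [H0|[S HS]] := set_0Vmem H.
  have : a <= 0.
    apply: le_trans (ha finset.set0 _) _; last by rewrite /cost big_set0.
    by apply/forall_inP => S; rewrite H0 inE.
  by move=> ale0; have -> : a = 0; [apply/le_anti/andP|rewrite mulr0].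
rewrite /miss_prob big1 ?mul0r // => W _.
have [_] := HP S HS; rewrite leqn0 cards_eq0 => /eqP S0.
suff -> : misses H W = false by rewrite mulr0.
apply/negbTE/negP => /forall_inP/(_ S HS); by rewrite S0 finset.sub0set.
Qed.

Lemma miss_bound_le {R : realType} {X : finType} (q : R) (G : {set X})
    (l : nat) (P eps eps' : R) :
  eps <= eps' -> miss_bound q G l P eps -> miss_bound q G l P eps'.
Proof.
move=> le_eps mb p Pp H HP a a0 ha; exact: le_trans (mb p Pp H HP a a0 ha) le_eps.
Qed.

(** After a first round [W1], the large fragments [U1 W1] have small expected cost. A cover of the
    small fragments [F] together with [U1 W1] covers [H], so covers of [F] cost at least
    [a - cost q (U1 W1)], and the bound for size [k] applies to [F] with this value in place of
    [a]. *)
Lemma miss_bound_step {R : realType} {X : finType} (q z : R) (G : {set X})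
    (k l : nat) (P1 P2 eps : R) :
  0 <= q -> 0 < P1 < 1 -> 0 <= P2 -> 0 <= eps -> q / P1 <= z -> 0 < z ->
  miss_bound q G k P2 eps ->
  miss_bound q G l (P1 + P2) ((q / P1 / z) ^+ k.+1 * (1 + z) ^+ l + eps).
Proof.
move=> q0 /andP[P10 P11] P20 eps0 qz z0 mb p /andP[Pp p1] H HP a a0 ha.
have P11' : 0 < 1 - P1 by rewrite subr_gt0.
(* Solves [1 - p = (1 - P1) * (1 - p2)], so the two rounds together have density exactly [p]. *)
pose p2 := (p - P1) / (1 - P1).
have P2p2 : P2 <= p2.
  rewrite ler_pdivlMr // lerBrDl; apply: le_trans Pp.
  by rewrite lerD2l ler_piMr // gerBl ltW.
have p21 : p2 <= 1 by rewrite ler_pdivrMr // mul1r lerD2r.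
have p20 : 0 <= p2 := le_trans P20 P2p2.
have defp : on_set G p =1 fun x => 1 - (1 - on_set G P1 x) * (1 - on_set G p2 x).
  move=> x; rewrite /on_set /p2; case: ifP => _; last by rewrite !subr0 mulr1 subrr.
  by field; rewrite gt_eqF.
have mu0 W : 0 <= rset_prob (on_set G P1) W.
  apply: rset_prob_ge0; [exact/on_set_ge0/ltW | exact/on_set_le1/ltW].
have nu0 W : 0 <= rset_prob (on_set G p2) W.
  by apply: rset_prob_ge0; [exact: on_set_ge0 | exact: on_set_le1].
pose M W1 := \sum_W2 rset_prob (on_set G p2) W2 * (misses H (W1 :|: W2))%:R.
have -> : miss_prob (on_set G p) H = \sum_W1 rset_prob (on_set G P1) W1 * M W1.
  rewrite /miss_prob /rset_prob.
  under eq_bigr => W _ do under eq_bigr => x _ do rewrite defp.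
  rewrite (sum_rset_prob_setU (on_set G P1) (on_set G p2) (fun W => (misses H W)%:R)).
  by apply: eq_bigr => W1 _; rewrite mulr_sumr; apply: eq_bigr => W2 _; rewrite mulrA.
pose U1 W1 := [set T in fragments H W1 | (k < #|T|)%N].
suff key W1 : M W1 * a <= cost q (U1 W1) + eps.
  rewrite mulr_suml.
  apply: (@le_trans _ _ (\sum_W1 rset_prob (on_set G P1) W1 * (cost q (U1 W1) + eps))).
    by apply: ler_sum => W _; rewrite -mulrA ler_wpM2l.
  under eq_bigr => W _ do rewrite mulrDr.
  rewrite big_split /= -mulr_suml sum_rset_prob mul1r lerD2r.
  by apply: sum_cost_fragments_le => //; rewrite P10 ltW.
have M0 : 0 <= M W1 by apply: sumr_ge0 => W _; rewrite mulr_ge0.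
have M1 : M W1 <= 1.
  rewrite -(sum_rset_prob (on_set G p2)); apply: ler_sum => W _.
  by rewrite ler_piMr // lern1 leq_b1.
pose F := [set T in fragments H W1 | (#|T| <= k)%N].
have MF : M W1 <= miss_prob (on_set G p2) F.
  apply: ler_sum => W _; rewrite ler_wpM2l // ler_nat.
  have [mH|//] := boolP (misses H (W1 :|: W)).
  rewrite (misses_fragments _ _ _ _ _ mH) //.
  by apply/fintype.subsetP => T; rewrite inE => /andP[].
(* If [U1 W1] already costs more than [a], the claim follows from [M W1 <= 1]; otherwise the
   difference is nonnegative, as the invariant requires. *)
have [ca|ac] := leP (cost q (U1 W1)) a; last first.
  apply: (@le_trans _ _ (cost q (U1 W1))); last by rewrite lerDl.
  by apply: le_trans (ltW ac); rewrite ler_piMl.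
suff : M W1 * (a - cost q (U1 W1)) <= eps.
  move=> le_eps; rewrite -[a](subrK (cost q (U1 W1))) mulrDr addrC lerD //.
  by rewrite ler_piMl // cost_ge0.
apply: (@le_trans _ _ (miss_prob (on_set G p2) F * (a - cost q (U1 W1)))).
  by rewrite ler_wpM2r // subr_ge0.
apply: mb; rewrite ?subr_ge0 //; first by rewrite P2p2.
  move=> T; rewrite inE => /andP[fT ->]; split=> //.
  have [S HS ->] := fragmentsP _ _ _ fT.
  by apply: fintype.subset_trans (subsetDl _ _) _; exact: (HP S HS).1.
move=> U cU; rewrite lerBlDl; apply: le_trans (cost_setU _ _ _ q0).
apply: ha; apply/forall_inP => S HS.
have [T fT sTS] := exists_fragment _ W1 _ HS.
have [kT|Tk] := ltnP k #|T|.
  by apply/exists_inP; exists T; rewrite // finset.in_setU [T \in U1 _]inE fT kT.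
have FT : T \in F by rewrite inE fT.
have /exists_inP[T' UT' sT'] := forall_inP cU T FT.
apply/exists_inP; exists T'; first by rewrite finset.in_setU UT' orbT.
exact: fintype.subset_trans sTS.
Qed.

Lemma exp_1Dinv_le {R : realType} (n : nat) : (1 + n%:R^-1) ^+ n <= expR 1 :> R.
Proof.
case: n => [|n]; first by rewrite expr0 -expR0 ler_expR.
apply: (@le_trans _ _ (expR n.+1%:R^-1 ^+ n.+1)).
  by rewrite lerXn2r ?nnegrE ?expR_ge0 ?expR_ge1Dx // addr_ge0 // invr_ge0.
by rewrite -expRM_natl mulfV ?pnatr_eq0.
Qed.

(** The induction runs backwards in time: its base is the last round, of density [L * q], and each
    step puts a round of density [16 * q] in front and doubles the admissible size. The factor
    [1 - 2^-1 ^+ r] sums a geometric series of errors. *)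
Lemma miss_bound_iter {R : realType} {X : finType} (q L : R) (G : {set X})
    (m r : nat) :
  0 < q -> (0 < m)%N -> m%:R <= L -> L * q < 1 -> 16 * q < 1 ->
  miss_bound q G (2 ^ r * m) ((L + 16 * r%:R) * q)
    (expR 1 * m%:R / L + 2^-1 ^+ m * (1 - 2^-1 ^+ r)).
Proof.
move=> q0 m0 mL Lq q16.
have m0R : 0 < m%:R :> R by rewrite ltr0n.
have L0 : 0 < L := lt_le_trans m0R mL.
elim: r => [|r IH].
  rewrite mul1n mulr0 addr0 expr0 subrr mulr0 addr0.
  (* With [k = 0] and [z = 1 / m] the error of this round is [(m / L) * (1 + 1 / m) ^ m], at most
     [e * m / L]. *)
  have /(miss_bound_step _ m%:R^-1) mb := @miss_bound0 R X q G 0.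
  rewrite -[L * q]addr0; apply: miss_bound_le (mb m (L * q) _ _ _ _ _ _) => //.
  - rewrite addr0 expr1 invrK.
    have -> : q / (L * q) * m%:R = m%:R / L by field; rewrite !gt_eqF.
    by rewrite -mulrA mulrC ler_wpM2r ?exp_1Dinv_le // divr_ge0 // ltW.
  - exact: ltW.
  - by rewrite Lq mulr_gt0.
  - have -> : q / (L * q) = L^-1 by field; rewrite !gt_eqF.
    by rewrite lef_pV2.
  - by rewrite invr_gt0.
have h0 : 0 <= 2^-1 :> R by rewrite invr_ge0.
have h1 : 2^-1 <= 1 :> R by rewrite invf_le1 ?ler1n.
have -> : (L + 16 * r.+1%:R) * q = 16 * q + (L + 16 * r%:R) * q by rewrite -natr1; ring.
apply: miss_bound_le (miss_bound_step q 1 G _ _ _ _ _ _ _ _ _ _ _ IH) => //.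
(* With [k = 2 ^ r * m] the error is [4 ^ (- k) / 16]; since [k >= m] and [k > r], it is at most
   [2 ^ (- m) * 2 ^ (- (r + 1))], the increment of the bound. *)
- rewrite [leLHS]addrC -addrA lerD2l exprS.
  have -> : q / (16 * q) / 1 = 16^-1 by field; rewrite gt_eqF.
  have -> : 1 + 1 = 2 :> R by [].
  rewrite expnS -mulnA [2 ^+ (2 * _)]exprM -[16^-1 * _ * _]mulrA -exprMn.
  have -> : 16^-1 * 2 ^+ 2 = 2^-1 * 2^-1 :> R by field.
  rewrite exprMn [2^-1 ^+ r.+1]exprS.
  set k := (2 ^ r * m)%N.
  have mk : (m <= k)%N by rewrite leq_pmull // expn_gt0.
  have rk : (r < k)%N by apply: leq_trans (ltn_expl r (isT : 1 < 2)%N) _; rewrite leq_pmulr.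
  have : 2^-1 ^+ k * 2^-1 ^+ k <= 2^-1 ^+ m * (2^-1 * 2^-1 ^+ r) :> R.
    by rewrite -exprS ler_pM ?exprn_ge0 // ler_wiXn2l.
  have : 0 <= 2^-1 ^+ k * 2^-1 ^+ k :> R by rewrite mulr_ge0 ?exprn_ge0.
  move: (2^-1 ^+ k * _) (2^-1 ^+ m) (2^-1 ^+ r) => /= u v w u0 uvw; lra.
- exact: ltW.
- by rewrite q16 mulr_gt0.
- by rewrite mulr_ge0 ?addr_ge0 ?mulr_ge0 // ltW.
- rewrite addr_ge0 ?divr_ge0 ?mulr_ge0 ?expR_ge0 ?exprn_ge0 ?(ltW L0) //.
  by rewrite subr_ge0 exprn_ile1.
- have -> : q / (16 * q) = 16^-1 by field; rewrite gt_eqF.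
  by rewrite invf_le1 // ler1n.
Qed.

(** Spread means that every cover costs at least 1: each index in [A] is charged to a member of the
    cover inside [S i], and spread bounds the charges. Hence the invariant applies with [a = 1].
    Counting indices keeps the multiplicity of equal sets [S i]. *)
Lemma spread_miss_prob {R : realType} {X I : finType} (q L p : R) (G : {set X})
    (A : {set I}) (S : I -> {set X}) (m r : nat) :
  A != finset.set0 ->
  (forall i, i \in A -> S i \subset G /\ (#|S i| <= 2 ^ r * m)%N) ->
  (forall T : {set X}, #|[set i in A | T \subset S i]|%:R <= q ^+ #|T| * #|A|%:R) ->
  0 < q -> (0 < m)%N -> m%:R <= L -> L * q < 1 -> 16 * q < 1 ->
  (L + 16 * r%:R) * q <= p <= 1 ->
  miss_prob (on_set G p) [set S i | i in A] <= expR 1 * m%:R / L + 2^-1 ^+ m.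
Proof.
move=> A0 SG spread q0 m0 mL Lq q16 hp.
rewrite -[leLHS]mulr1; apply: (@le_trans _ _ (expR 1 * m%:R / L + 2^-1 ^+ m * (1 - 2^-1 ^+ r))).
  apply: (miss_bound_iter q L G m r) hp _ _ _ _ _ => //.
    by move=> _ /imsetP[i Ai ->]; exact: SG.
  move=> U /forall_inP cU.
  have A0R : 0 < #|A|%:R :> R by rewrite ltr0n card_gt0.
  rewrite -(ler_pM2r A0R) mul1r /cost mulr_suml.
  apply: (@le_trans _ _ (\sum_(T in U) #|[set i in A | T \subset S i]|%:R)).
    rewrite -natr_sum ler_nat.
    apply: (@leq_trans #|\bigcup_(T in U) [set i in A | T \subset S i]|).
      apply/subset_leq_card/fintype.subsetP => i Ai.
      have /exists_inP[T UT sT] := cU (S i) (imset_f S Ai).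
      by apply/finset.bigcupP; exists T; rewrite ?inE ?Ai.
    elim/big_rec2: _ => [|T B n _ leB]; first by rewrite cards0.
    by apply: leq_trans (leq_card_setU _ _) _; rewrite leq_add2l.
  by apply: ler_sum => T _.
by rewrite lerD2l ler_piMr ?exprn_ge0 // gerBl exprn_ge0.
Qed.

(** * Counting embeddings of directed forests *)

(** Each inductive step lowers the base from [b + 1] to [b] under an exponent [s <= b], at the price
    of [(1 + 1 / b) ^ s], at most [e]. *)
Lemma exp_le_ffact {R : realType} (s a : nat) : (s <= a)%N ->
  a%:R ^+ s <= expR 1 ^+ s * (a ^_ s)%:R :> R.
Proof.
elim: s a => [|s IH] [|b] //= sb; try by rewrite !expr0 ffactn0 mul1r.
rewrite !exprS ffactSS natrM [leRHS]mulrCA ler_wpM2l // -mulrA.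
apply: le_trans (ler_wpM2l (expR_ge0 1) (IH b sb)).
case: b sb {IH} => [|b] sb.
  by move: sb; rewrite ltnS leqn0 => /eqP ->; rewrite !expr0 mulr1 -expR0 ler_expR.
have -> : b.+2%:R = b.+1%:R * (1 + b.+1%:R^-1) :> R.
  by rewrite mulrDr mulr1 mulfV ?pnatr_eq0 // natr1.
rewrite exprMn mulrC ler_wpM2r ?exprn_ge0 //.
apply: le_trans (exp_1Dinv_le b.+1).
by rewrite ler_weXn2l // lerDl invr_ge0.
Qed.

(* Compose an embedding [t] in the left-hand set with any permutation [s] fixing
   the roots and the sources [X] of the forest [B]. The composite [s * t] still
   determines [t] on [X], hence on all of [B] by following its edges, and so [s]
   up to the permutations fixing the vertices of [B]. *)
Lemma card_forest_embeddings {T : finType} (sc : rel T) (rank : T -> nat)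
    (V X Y : {set T}) (B : {set T * T}) :
  (forall x y, sc x y -> (rank x < rank y)%N) ->
  (forall x y y', sc x y -> sc x y' -> y = y') ->
  [set e.1 | e in B] \subset V :|: X :|: Y ->
  Y = [set e.2 | e in B] ->
  (#|[set t : {perm T} | perm_on (~: V) t &&
        [forall e in B, sc (t e.1) (t e.2)]]| * (#|~: (V :|: X)|)`!
   <= (#|~: V|)`! * (#|~: (V :|: X :|: Y)|)`!)%N.
Proof.
move=> sc_rank sc_fun subX defY; set A := [set t | _].
pose Q (S : {set T}) := [set t : {perm T} | perm_on S t].
have cardQ (S : {set T}) : (#|S|)`! = #|Q S| by rewrite cardsE card_perm.
rewrite !cardQ -cardsX.
pose comp (u : {perm T} * {perm T}) := (u.2 * u.1)%g.
rewrite -[leqLHS]sum1_card (partition_big comp (mem (Q (~: V)))) /=; last first.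
  move=> [t s]; rewrite finset.in_setX !inE => /andP[/andP[tV _] sV]; apply: perm_onM => //.
  by apply: fintype.subset_trans sV _; rewrite finset.setCS finset.subsetUl.
rewrite -sum_nat_const; apply: leq_sum => w _.
have [/existsP[[t0 s0] /= /andP[h0 /eqP w0]]|] := boolP
  [exists u, (u \in finset.setX A (Q (~: (V :|: X)))) && (comp u == w)]; last first.
  by move=> /existsPn none; rewrite big1 // => u hu; have := none u; rewrite hu.
move: h0; rewrite finset.in_setX !inE => /andP[/andP[t0V /forall_inP t0B] s0X].
have fixX (s : {perm T}) (x : T) :
    perm_on (~: (V :|: X)) s -> x \in V :|: X -> s x = x.
  by move=> sX xVX; apply: (out_perm sX); rewrite inE negbK.
rewrite sum1_card.
(* For a fixed composite [w], the second component determines the pair. Compared with the reference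
   [s0], it becomes a permutation fixing all of [V :|: X :|: Y], which gives the second
   factorial. *)
pose g (u : {perm T} * {perm T}) := (s0^-1 * u.2)%g.
pose P := [set u | (u \in finset.setX A (Q (~: (V :|: X)))) && (comp u == w)].
have -> : #|[pred u | (u \in finset.setX A (Q (~: (V :|: X)))) && (comp u == w)]| = #|P|.
  by rewrite cardsE.
rewrite -(card_in_imset (f := g) (D := mem P)); last first.
  move=> [t s] [t' s']; rewrite !inE /= => /andP[_ /eqP hw] /andP[_ /eqP hw'].
  rewrite /g /= => /mulgI es; congr (_, _) => //.
  by move: hw; rewrite -hw' /comp /= es => /mulgI.
apply/subset_leq_card/fintype.subsetP => _ /imsetP[[t s] + ->].
rewrite !inE /= => /andP[/andP[/andP[tV /forall_inP tB] sX] /eqP hw].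
have ew x : t (s x) = t0 (s0 x).
  by move/permP/(_ x): hw; rewrite -w0 /comp !permM.
have eVX x : x \in V :|: X -> t x = t0 x.
  by move=> xVX; have := ew x; rewrite (fixX _ _ sX xVX) (fixX _ _ s0X xVX).
(* Induction on the rank of [t y]: the source of an edge into [y] has smaller rank, or lies in
   [V :|: X]. *)
have eY n y : (rank (t y) < n)%N -> y \in Y -> t y = t0 y.
  elim: n y => // n IH y le_n; rewrite {1}defY => /imsetP[[x y'] Bxy /= ey].
  rewrite {y}ey in le_n *.
  have sct := tB _ Bxy; have sct0 := t0B _ Bxy; rewrite /= in sct sct0.
  suff ex : t x = t0 x by apply: sc_fun sct _; rewrite ex.
  have : x \in V :|: X :|: Y by apply: (fintype.subsetP subX); apply/imsetP; exists (x, y').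
  rewrite finset.in_setU => /orP[/eVX//|]; apply: IH.
  exact: leq_trans (sc_rank _ _ sct) le_n.
apply/fintype.subsetP => x; rewrite [x \in ~: _]inE; apply: contraR; rewrite negbK.
rewrite finset.in_setU => /orP[xVX|xY]; apply/eqP; rewrite /g permM /=.
  by rewrite (fixX _ _ (perm_onV s0X)) // fixX.
apply: (@perm_inj _ t); rewrite ew permKV; exact/esym/(eY _.+1).
Qed.

(** Take for [X] the sources that are neither in [V] nor targets. With [a] vertices outside
    [V :|: X], the preceding count bounds [#|A| * a ^_ s] by the factorial of [N]. As
    [#|X| <= s <= a], also [N <= 2 * a], whence the 2; the factor [e] comes from comparing [a ^ s]
    with [a ^_ s]. *)
Lemma card_forest_embeddings_le {R : realType} {T : finType} (sc : rel T)
    (rank : T -> nat) (V : {set T}) (B : {set T * T}) :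
  (forall x y, sc x y -> (rank x < rank y)%N) ->
  (forall x y y', sc x y -> sc x y' -> y = y') ->
  (forall x x' y, sc x y -> sc x' y -> x = x') ->
  (forall x y, sc x y -> y \notin V) ->
  #|[set t : {perm T} | perm_on (~: V) t &&
        [forall e in B, sc (t e.1) (t e.2)]]|%:R
    <= (2 * expR 1 / #|~: V|%:R) ^+ #|B| * #|[set t : {perm T} | perm_on (~: V) t]|%:R :> R.
Proof.
move=> sc_rank sc_fun sc_inj scV; 
have -> : #|[set t : {perm T} | perm_on (~: V) t]| = (#|~: V|)`!.
  by rewrite cardsE card_perm.
set A := [set t | _]; set N := #|~: V|; set s := #|B|.
have e0 : 0 < expR 1 :> R := expR_gt0 1.
(* A single embedding [t] shows that the pairs of [B] have distinct targets, all outside [V]. *)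
have [A0|[t]] := set_0Vmem A.
  rewrite A0 cards0 mulr_ge0 // exprn_ge0 // divr_ge0 // mulr_ge0 //; exact: ltW.
rewrite inE => /andP[tV /forall_inP tB].
pose Y := [set e.2 | e in B].
pose X := [set e.1 | e in B] :\: (V :|: Y).
have cardY : #|Y| = s.
  apply: card_in_imset => -[x y] [x' y'] Bxy Bxy' /= eyy'; rewrite -eyy' in Bxy' *.
  have := sc_inj _ _ _ (tB _ Bxy) (tB _ Bxy') => /= /perm_inj ->.
  by [].
have dVY : [disjoint V & Y].
  rewrite disjoint_sym finset.disjoints_subset; apply/fintype.subsetP => y /imsetP[[x y'] Bxy /= ->].
  rewrite inE; apply: contra (scV _ _ (tB _ Bxy)) => y'V /=.
  by rewrite (out_perm tV) // inE negbK.
have cardX : (#|X| <= s)%N.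
  by apply: leq_trans (subset_leq_card (subsetDl _ _)) _; exact: leq_imset_card.
pose a := #|~: (V :|: X)|; pose b := #|~: (V :|: X :|: Y)|.
have dVX : [disjoint V & X].
  rewrite disjoint_sym finset.disjoints_subset; apply/fintype.subsetP => x.
  by rewrite !inE => /andP[]; rewrite negb_or => /andP[].
have dXY : [disjoint X & Y].
  rewrite finset.disjoints_subset; apply/fintype.subsetP => x.
  by rewrite !inE => /andP[]; rewrite negb_or => /andP[].
have disj_card (C D : {set T}) : [disjoint C & D] -> #|~: C| = (#|D| + #|~: (C :|: D)|)%N.
  move=> dCD; have := cardsC (C :|: D); rewrite -(cardsC C) cardsU.
  by rewrite (disjoint_setI0 dCD) cards0 subn0 -addnA => /eqP; rewrite eqn_add2l => /eqP.
have NE : N = (#|X| + a)%N by exact: disj_card.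
have aE : a = (s + b)%N.
  rewrite -cardY; apply: disj_card; rewrite -setI_eq0 finset.setIUl.
  by rewrite (disjoint_setI0 dVY) (disjoint_setI0 dXY) finset.setU0.
have key : (#|A| * a ^_ s <= N`!)%N.
  have subX : [set e.1 | e in B] \subset V :|: X :|: Y.
    apply/fintype.subsetP => x Bx; rewrite !inE Bx andbT.
    by case: (x \in V); case: (x \in Y).
  have := @card_forest_embeddings _ sc rank V X Y B sc_rank sc_fun subX erefl.
  rewrite -/A -/N -/a -/b.
  have sa : (s <= a)%N by rewrite aE leq_addr.
  rewrite -(ffact_fact sa) aE addKn -aE mulnA leq_pmul2r ?fact_gt0 //.
have keyR : #|A|%:R * (a ^_ s)%:R <= N`!%:R :> R by rewrite -natrM ler_nat.
have N2a : N%:R <= 2 * a%:R :> R.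
  rewrite NE natrD mulr2n mulrDl !mul1r lerD2r ler_nat aE.
  by apply: leq_trans cardX _; rewrite leq_addr.
have sa : (s <= a)%N by rewrite aE leq_addr.
have [s0|s_gt0] := posnP s.
  by move: keyR; rewrite s0 ffactn0 expr0 mulr1 mul1r.
have N0 : 0 < N%:R :> R by rewrite ltr0n NE aE; apply: leq_trans s_gt0 _; rewrite addnCA leq_addr.
rewrite expr_div_n mulrAC ler_pdivlMr ?exprn_gt0 //.
apply: (@le_trans _ _ (#|A|%:R * (2 ^+ s * (expR 1 ^+ s * (a ^_ s)%:R)))).
  apply: ler_wpM2l => //; apply: (@le_trans _ _ ((2 * a%:R) ^+ s)).
    by rewrite lerXn2r ?nnegrE // mulr_ge0.
  by rewrite exprMn ler_wpM2l ?exprn_ge0 // exp_le_ffact.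
rewrite exprMn mulrCA [X in _ * X]mulrCA mulrA ler_wpM2l //.
Qed.

(** * Spread of the undirected edge sets *)

(** The relation is pulled back along [t]: for a permutation [t], this is the image of the layout
    [sc] under the inverse of [t]. *)
Definition image_edges {T : finType} (sc : rel T) (t : T -> T) : {set {set T}} :=
  [set [set e.1; e.2] | e : T * T & sc (t e.1) (t e.2)].

Lemma image_edgesP {T : finType} (sc : rel T) (t : T -> T) (E : {set T}) :
  reflect (exists2 e : T * T, sc (t e.1) (t e.2) & E = [set e.1; e.2])
          (E \in image_edges sc t).
Proof. by apply: (iffP imsetP) => -[e]; rewrite ?inE => he ->; exists e; rewrite ?inE. Qed.

Lemma eq_set2 {T : finType} (a b x y : T) : [set a; b] = [set x; y] :> {set T} ->
  (a = x /\ b = y) \/ (a = y /\ b = x).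
Proof.
move=> eq2.
have : a \in [set x; y] by rewrite -eq2 !inE eqxx.
have : b \in [set x; y] by rewrite -eq2 !inE eqxx orbT.
have : x \in [set a; b] by rewrite eq2 !inE eqxx.
have : y \in [set a; b] by rewrite eq2 !inE eqxx orbT.
rewrite !inE => /orP[]/eqP + /orP[]/eqP + /orP[]/eqP + /orP[]/eqP.
all: by move=> ? ? ? ?; subst; auto.
Qed.

(** A union bound over the [2 ^ #|F|] orientations of [F] turns the 2 of the directed bound into a
    4. *)
Lemma image_edges_spread {R : realType} {T : finType} (sc : rel T)
    (rank : T -> nat) (V : {set T}) (F : {set {set T}}) :
  (forall x y, sc x y -> (rank x < rank y)%N) ->
  (forall x y y', sc x y -> sc x y' -> y = y') ->
  (forall x x' y, sc x y -> sc x' y -> x = x') ->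
  (forall x y, sc x y -> y \notin V) ->
  #|[set t in [set t : {perm T} | perm_on (~: V) t] | F \subset image_edges sc t]|%:R
    <= (4 * expR 1 / #|~: V|%:R) ^+ #|F| * #|[set t : {perm T} | perm_on (~: V) t]|%:R :> R.
Proof.
move=> sc_rank sc_fun sc_inj scV.
set Q := [set t : {perm T} | _]; set A := [set t in Q | _].
have e0 : 0 < expR 1 :> R := expR_gt0 1.
have [F0|[E0 FE0]] := set_0Vmem F.
  rewrite F0 cards0 expr0 mul1r ler_nat subset_leq_card //.
  by apply/fintype.subsetP => t; rewrite inE => /andP[].
have [A0|[t0]] := set_0Vmem A.
  rewrite A0 cards0 mulr_ge0 // exprn_ge0 // divr_ge0 // mulr_ge0 //; exact: ltW.
rewrite inE => /andP[_ /fintype.subsetP Ft0].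
(* [d] only serves as the default value of [phi]. *)
have [d _ _] := image_edgesP _ _ _ (Ft0 _ FE0).
pose phi (E : {set T}) := odflt d [pick e | E == [set e.1; e.2]].
have phiE E : E \in F -> E = [set (phi E).1; (phi E).2].
  move=> FE; rewrite /phi; case: pickP => [e /eqP//|none].
  by have [e _ /eqP] := image_edgesP _ _ _ (Ft0 _ FE); rewrite none.
(* [phi] orients every edge of [F]; the orientation read off an embedding is
   [o Z] for one of the [2 ^ #|F|] sets [Z] of edges on which it agrees with [phi]. *)
pose o (Z : {set {set T}}) E := if E \in Z then phi E else ((phi E).2, (phi E).1).
have oE Z E : E \in F -> E = [set (o Z E).1; (o Z E).2].
  by move=> FE; rewrite /o; case: ifP => _ /=; [|rewrite finset.setUC]; exact: phiE.
pose B Z := [set o Z E | E in F].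
have cardB Z : #|B Z| = #|F|.
  apply: card_in_imset => E E' FE FE' eo.
  by rewrite (oE Z E FE) (oE Z E' FE') eo.
pose AB Z := [set t : {perm T} | perm_on (~: V) t &&
        [forall e in B Z, sc (t e.1) (t e.2)]].
apply: (@le_trans _ _ (\sum_(Z in powerset F) #|AB Z|%:R)).
  rewrite -natr_sum ler_nat.
  apply: (@leq_trans #|\bigcup_(Z in powerset F) AB Z|).
    apply/subset_leq_card/fintype.subsetP => t.
    rewrite !inE => /andP[tV /fintype.subsetP Ft].
    apply/finset.bigcupP; exists [set E in F | sc (t (phi E).1) (t (phi E).2)].
      by rewrite powersetE; apply/fintype.subsetP => E; rewrite inE => /andP[].
    rewrite inE tV; apply/forall_inP => _ /imsetP[E FE ->].
    rewrite /o inE FE /=; case: ifPn => //= nsc.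
    have [[x y] /= scxy eE] := image_edgesP _ _ _ (Ft _ FE).
    move: eE; rewrite {1}(phiE _ FE) => /eq_set2[] [ex ey].
      by rewrite ex ey scxy in nsc.
    by rewrite ex ey.
  elim/big_rec2: _ => [|T' B' n _ leB]; first by rewrite cards0.
  by apply: leq_trans (leq_card_setU _ _) _; rewrite leq_add2l.
apply: (@le_trans _ _ (\sum_(Z in powerset F) (2 * expR 1 / #|~: V|%:R) ^+ #|F| * #|Q|%:R)).
  apply: ler_sum => Z _; rewrite -(cardB Z).
  exact: card_forest_embeddings_le sc_rank sc_fun sc_inj scV.
rewrite sumr_const card_powerset -[leLHS]mulr_natl mulrA natrX -exprMn.
by rewrite !mulrA -natrM.
Qed.

Lemma image_edges_sub {T : finType} (sc : rel T) (t : {perm T}) :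
  (forall x, ~~ sc x x) ->
  image_edges sc t \subset [set E : {set T} | #|E| == 2%N].
Proof.
move=> irr; apply/fintype.subsetP => E /image_edgesP[[x y] /= scxy ->].
rewrite inE cards2; have [exy|//] := eqVneq x y.
by rewrite exy (negPf (irr (t y))) in scxy.
Qed.

Lemma card_image_edges {T : finType} (sc : rel T) (t : {perm T}) :
  (forall x x' y, sc x y -> sc x' y -> x = x') ->
  (#|image_edges sc t| <= #|T|)%N.
Proof.
move=> sc_inj; apply: leq_trans (leq_imset_card _ _) _.
rewrite -cardsE -(@card_in_imset _ _ snd) ?max_card // => -[x y] [x' y'].
rewrite !inE /= => h h' eyy'; rewrite -eyy' in h' *.
by have /perm_inj -> := sc_inj _ _ _ h h'.
Qed.

(** * The reference layout of the paths *)

(** Values are corrected one at a time by a transposition, which by injectivity moves none of the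
    earlier ones. *)
Lemma inj_extend_perm {T : finType} {m : nat} (u v : 'I_m -> T) :
  injective u -> injective v -> exists b : {perm T}, forall i, b (u i) = v i.
Proof.
move=> u_inj v_inj.
suff ext j : (j <= m)%N ->
    exists b : {perm T}, forall i : 'I_m, (i < j)%N -> b (u i) = v i.
  by have [b hb] := ext m (leqnn m); exists b => i; exact: hb.
elim: j => [|j IH] jm; first by exists 1%g.
have [b hb] := IH (ltnW jm).
exists (b * tperm (b (u (Ordinal jm))) (v (Ordinal jm)))%g => i.
rewrite ltnS leq_eqVlt permM => /orP[/eqP ij|ij].
  by have -> : i = Ordinal jm by [exact: val_inj]; rewrite tpermL.
have neq : i != Ordinal jm by rewrite -val_eqE /= ltn_eqF.
rewrite (hb i ij) tpermD //; last by rewrite (inj_eq v_inj) eq_sym.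
by rewrite -(hb i ij) (inj_eq perm_inj) (inj_eq u_inj) eq_sym.
Qed.

(* Lists the vertices along the paths of a reference layout, [k] to a path:
   [b] maps the place [i * k + j] to the [j]-th vertex of the [i]-th path. *)
Definition next_on_path {n : nat} (k : nat) (b : {perm 'I_n}) (x y : 'I_n) : bool :=
  (b^-1%g y == (b^-1%g x).+1 :> nat) && ~~ (k %| b^-1%g y)%N.

Lemma next_on_path_fun {n k : nat} (b : {perm 'I_n}) (x y y' : 'I_n) :
  next_on_path k b x y -> next_on_path k b x y' -> y = y'.
Proof.
move=> /andP[/eqP e _] /andP[/eqP e' _].
by apply: (@perm_inj _ b^-1%g); apply: val_inj; rewrite /= e e'.
Qed.

Lemma next_on_path_inj {n k : nat} (b : {perm 'I_n}) (x x' y : 'I_n) :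
  next_on_path k b x y -> next_on_path k b x' y -> x = x'.
Proof.
move=> /andP[/eqP e _] /andP[/eqP e' _].
by apply: (@perm_inj _ b^-1%g); apply: val_inj; apply: succn_inj; rewrite -e -e'.
Qed.

(** The [i]-th path reads the places [i * k + j] for [j < k] through [b] and then the inverse of
    [t]; place [i * k] gives [v i], which [t] fixes. *)
Lemma has_path_cover_image_edges {n k m : nat} (v : 'I_m -> 'I_n)
    (u : 'I_m -> 'I_n) (b t : {perm 'I_n}) (E : {set {set 'I_n}}) :
  (0 < k)%N -> n = (m * k)%N -> (forall i, u i = (i * k)%N :> nat) ->
  (forall i, b (u i) = v i) -> (forall i, t (v i) = v i) ->
  image_edges (next_on_path k b) t \subset E -> has_path_cover k v E.
Proof.
case: k => // k _ defn uE bu tv /fintype.subsetP sE.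
(* The default [u i] is never reached for [j < k.+1]: such places stay below [n]. *)
pose f i j := t^-1%g (b (insubd (u i) (i * k.+1 + j)%N)).
have posE (i : 'I_m) j : (j < k.+1)%N -> insubd (u i) (i * k.+1 + j)%N = (i * k.+1 + j)%N :> nat.
  move=> jk; rewrite val_insubd; case: ifP => // /negP[]; rewrite [X in (_ < X)%N]defn.
  apply: (@leq_trans (i.+1 * k.+1)); last by rewrite leq_mul2r ltn_ord orbT.
  by rewrite mulSn addnC ltn_add2r.
have f_inj i i' j j' : (j < k.+1)%N -> (j' < k.+1)%N -> f i j = f i' j' -> i = i' /\ j = j'.
  move=> jk jk' /perm_inj/perm_inj/(congr1 val) /=; rewrite !posE // => e.
  have ei : i = i' :> nat.
    by have := congr1 (divn^~ k.+1) e; rewrite /= !divnMDl // !divn_small // !addn0.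
  by split; [exact: val_inj | apply/eqP; rewrite -(eqn_add2l (i * k.+1)) {2}ei e].
exists (fun i => [seq f i j | j <- iota 0 k.+1]); split=> [i|i i' neq].
  split; last first.
    split; first by rewrite size_map size_iota.
    rewrite /is_endpoint; apply/orP; left => /=.
    apply/eqP; congr Some; rewrite /f.
    have -> : insubd (u i) (i * k.+1 + 0)%N = u i.
      by apply: val_inj; rewrite /= posE // addn0 uE.
    by rewrite bu -[in LHS]tv permK.
  rewrite /is_graph_path; apply/andP; split.
    rewrite map_inj_in_uniq ?iota_uniq // => j j'; rewrite !mem_iota /= !add0n => jk jk'.
    by case/(f_inj _ _ _ _ jk jk').
  have edge j : (j.+1 < k.+1)%N -> adj E (f i j) (f i j.+1).
    move=> jk; apply: sE; apply/image_edgesP; exists (f i j, f i j.+1) => //=.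
    rewrite /next_on_path /f !permKV !permK !posE //; last exact: ltnW.
    by rewrite addnS eqxx /= -addnS dvdn_addr ?dvdn_mull // gtnNdvd.
  rewrite /= path_map; apply/(pathP 0%N) => j; rewrite size_iota => jk.
  have -> : (0%N :: iota 1 k) = iota 0 k.+1 by [].
  by rewrite !nth_iota //= ?add0n ?add1n; [exact: edge | exact: ltnW].
apply/pred0P => x; apply/negP => /andP[xi xi'].
have /seq.mapP[j + xE] := xi; have /seq.mapP[j' + xE'] := xi'.
rewrite xE in xE'; rewrite !mem_iota !add0n /= => jk' jk.
by have [/eqP] := f_inj _ _ _ _ jk jk' xE'; rewrite (negPf neq).
Qed.

(** * Transfer to the binomial random graph *)

Lemma Gnp_probE {R : realType} (n : nat) (p : R) (P : {set {set 'I_n}} -> bool) :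
  Gnp_prob p P =
  \sum_E rset_prob (on_set [set e : {set 'I_n} | #|e| == 2%N] p) E * (P E)%:R.
Proof.
set G := [set e | _].
have graphE (E : {set {set 'I_n}}) : is_graph E = (E \subset G).
  apply/forall_inP/fintype.subsetP => h e /h; by rewrite inE.
have cardG : #|G| = 'C(n, 2) by rewrite /G card_draws card_ord.
rewrite /Gnp_prob big_mkcond; apply: eq_bigr => E _; rewrite graphE.
case: ifPn => [/andP[sEG ->]|]; last first.
  rewrite negb_and => /orP[/subsetPn[e Ee eG]|/negPf ->]; last by rewrite mulr0.
  by rewrite /rset_prob (bigD1 e) //= Ee /on_set (negPf eG) !mul0r.
rewrite mulr1 -cardG -cardsDS // -!prod_if_const -big_split /=.
apply: eq_bigr => e _; rewrite /on_set inE.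
have [Ee|nEe] := boolP (e \in E); first by rewrite (fintype.subsetP sEG) // mulr1.
by rewrite mul1r /=; case: ifP => //; rewrite subr0.
Qed.

Lemma Gnp_prob_ge_miss {R : realType} (n : nat) (p : R)
    (P : {set {set 'I_n}} -> bool) (H : {set {set {set 'I_n}}}) :
  0 <= p <= 1 -> (forall E, ~~ misses H E -> P E) ->
  1 - miss_prob (on_set [set e : {set 'I_n} | #|e| == 2%N] p) H <= Gnp_prob p P.
Proof.
move=> /andP[p0 p1] HP; rewrite Gnp_probE lerBlDr -big_split /=.
set G := [set e | _]; rewrite -[X in X <= _](sum_rset_prob (on_set G p)); apply: ler_sum => E _.
rewrite -mulrDr ler_peMr //.
  by apply: rset_prob_ge0; [exact: on_set_ge0 | exact: on_set_le1].
rewrite -natrD ler1n addn_gt0; have := HP E.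
by case: (misses H E); rewrite ?orbT //= => ->.
Qed.

Lemma Gnp_prob_le1 {R : realType} (n : nat) (p : R) (P : {set {set 'I_n}} -> bool) :
  0 <= p <= 1 -> Gnp_prob p P <= 1.
Proof.
move=> /andP[p0 p1]; rewrite Gnp_probE.
set G := [set e | _]; rewrite -[X in _ <= X](sum_rset_prob (on_set G p)); apply: ler_sum => E _.
rewrite ler_piMr ?lern1 ?leq_b1 //.
by apply: rset_prob_ge0; [exact: on_set_ge0 | exact: on_set_le1].
Qed.

(** A quantitative form with [m] and [L] free: a large constant [m] makes the second error small,
    then [L] of order [ln n] the first. *)
Lemma Gnp_path_cover_ge {R : realType} (n k m r : nat) (L p : R)
    (v : 'I_(n %/ k) -> 'I_n) :
  (0 < n)%N -> (0 < k)%N -> (k %| n)%N -> injective v ->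
  (0 < m)%N -> (0 < r)%N -> (n <= 2 ^ r)%N -> m%:R <= L ->
  (L + 16 * r%:R) * (8 * expR 1 / n%:R) <= p <= 1 ->
  1 - (expR 1 * m%:R / L + 2^-1 ^+ m) <= Gnp_prob p (has_path_cover_b k v).
Proof.
move=> n0 k0 kn v_inj m0 r0 nr mL hp.
have m0R : 0 < m%:R :> R by rewrite ltr0n.
have n0R : 0 < n%:R :> R by rewrite ltr0n.
have L0 : 0 < L := lt_le_trans m0R mL.
set q := 8 * expR 1 / n%:R in hp.
have q0 : 0 < q by rewrite divr_gt0 // mulr_gt0 // expR_gt0.
have r1 : 1 <= r%:R :> R by rewrite ler1n.
have Lq0 : 0 < L * q by rewrite mulr_gt0.
have rq : q <= r%:R * q by rewrite ler_peMl // ltW.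
have [hpl hpu] := andP hp.
(* Both summands are positive, so this yields the strict bounds [L * q < 1] and [16 * q < 1] needed
   at the end. *)
have Lrq : L * q + 16 * (r%:R * q) <= 1.
  by apply: le_trans hpu; apply: le_trans hpl; rewrite [leRHS]mulrDl mulrA.
have p01 : 0 <= p <= 1.
  rewrite hpu andbT; apply: le_trans hpl; rewrite mulr_ge0 ?(ltW q0) //.
  by rewrite addr_ge0 ?(ltW L0) // mulr_ge0.
(* For [k = 1] every vertex is a root and no spread bound is available, but paths on one vertex need
   no edges: the family holding only the empty set is never missed. *)
have [k1|k_gt1] : (k = 1%N) \/ (1 < k)%N.
  by move: k0; rewrite leq_eqVlt => /orP[/eqP <-|]; [left | right].
  apply: (@le_trans _ _ (1 - miss_prob (on_set [set e : {set 'I_n} | #|e| == 2%N] p)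
      [set finset.set0])).
    rewrite lerD2l lerN2 {1}/miss_prob big1.
      by rewrite addr_ge0 ?exprn_ge0 ?invr_ge0 // divr_ge0 ?(ltW L0) // mulr_ge0 ?expR_ge0.
    move=> W _; suff -> : misses [set finset.set0] W = false by rewrite mulr0.
    apply/negbTE/negP => /forall_inP/(_ finset.set0).
    by rewrite inE eqxx finset.sub0set => /(_ isT).
  apply: Gnp_prob_ge_miss => // E _; apply/asboolP; exists (fun i => [:: v i]).
  split=> [i|i j neq].
    by rewrite /is_graph_path /is_endpoint /= eqxx k1.
  apply/pred0P => x /=; rewrite !inE; apply/negP => /andP[/eqP -> /eqP/v_inj ij].
  by rewrite ij eqxx in neq.
pose mm := (n %/ k)%N.
have defn : n = (mm * k)%N by rewrite divnK.
have u_lt (i : 'I_mm) : (i * k < n)%N by rewrite [X in (_ < X)%N]defn ltn_pmul2r.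
pose u i := Ordinal (u_lt i).
have u_inj : injective u.
  move=> i j /(congr1 val) /= /eqP; rewrite eqn_pmul2r // => /eqP; exact: val_inj.
have [b bu] := inj_extend_perm _ _ u_inj v_inj.
pose sc := next_on_path k b.
pose V := [set v i | i : 'I_mm].
pose A := [set t : {perm 'I_n} | perm_on (~: V) t].
have scV x y : sc x y -> y \notin V.
  move=> /andP[_]; apply: contra => /imsetP[i _ ->].
  by rewrite -bu permK /= dvdn_mull.
have sc_rank x y : sc x y -> (b^-1%g x < b^-1%g y)%N by case/andP => /eqP ->.
(* As [k >= 2], at most half of the vertices are roots; this turns the 4 of the spread bound into
   the 8 of [q]. *)
have cardV : (n <= 2 * #|~: V|)%N.
  have := cardsC V; rewrite card_imset // !card_ord => cV.
  have : (mm * 2 <= n)%N by rewrite [X in (_ <= X)%N]defn leq_mul2l k_gt1 orbT.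
  move=> h; rewrite -{1}cV in h; rewrite -[X in (X <= _)%N]cV mul2n -addnn leq_add2r.
  by move: h; rewrite muln2 -addnn leq_add2l.
have cV0 : 0 < #|~: V|%:R :> R.
  by rewrite ltr0n; move: (leq_trans n0 cardV); rewrite muln_gt0.
have qV : 4 * expR 1 / #|~: V|%:R <= q.
  rewrite /q ler_pdivlMr // mulrAC ler_pdivrMr //.
  have : n%:R <= 2 * #|~: V|%:R :> R by rewrite -natrM ler_nat.
  have : 0 < expR 1 :> R := expR_gt0 1.
  move: (expR 1) => e e0 le_n.
  have -> : 8 * e * #|~: V|%:R = 4 * e * (2 * #|~: V|%:R) by ring.
  by rewrite ler_wpM2l // mulr_ge0 // ltW.
have A0 : A != finset.set0 by apply/set0Pn; exists 1%g; rewrite inE perm_on1.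
apply: le_trans _ (Gnp_prob_ge_miss _ _ _ [set image_edges sc (t : {perm 'I_n}) | t in A] p01 _); last first.
  move=> E /forall_inPn[_ /imsetP[t At ->]]; rewrite negbK => sE.
  apply/asboolP; apply: (has_path_cover_image_edges v u b t E k0 defn _ bu _ sE) => //.
  move=> i; move: At; rewrite inE => tV; apply: (out_perm tV).
  by rewrite inE negbK imset_f.
rewrite lerD2l lerN2.
apply: (spread_miss_prob q L p _ A (image_edges sc) m r) => //.
- move=> t _; split.
    apply: image_edges_sub => x; apply/negP => /sc_rank; by rewrite ltnn.
  apply: leq_trans (card_image_edges _ _ _) _; first exact: next_on_path_inj.
  by rewrite card_ord (leq_trans nr) // leq_pmulr.
- move=> F; apply: le_trans (image_edges_spread sc (fun x => b^-1%g x) V F _ _ _ _) _ => //.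
  + exact: next_on_path_fun.
  + exact: next_on_path_inj.
  + by rewrite ler_wpM2r // lerXn2r ?nnegrE ?(ltW q0)//.
- lra.
- lra.
Qed.

(** * Asymptotics *)

(** [ln x] is twice the logarithm of the square root of [x], hence at most twice that root, while
    [2 * K] is at most the root. *)
Lemma mul_ln_le {R : realType} (K x : R) :
  0 < K -> 4 * K ^+ 2 <= x -> K * ln x <= x.
Proof.
move=> K0 Kx.
have x0 : 0 < x by apply: lt_le_trans Kx; rewrite mulr_gt0 // exprn_gt0.
have s0 : 0 < Num.sqrt x by rewrite sqrtr_gt0.
have lnx : ln x <= 2 * Num.sqrt x.
  rewrite -[in leLHS](sqr_sqrtr (ltW x0)) lnXn // -[leLHS]mulr_natl ler_wpM2l //.
  exact/ltW/ln_sublinear.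
have Ks : 2 * K <= Num.sqrt x.
  rewrite -(ler_pXn2r (n := 2)) ?nnegrE ?mulr_ge0 ?(ltW K0) ?sqrtr_ge0 //.
  by rewrite sqr_sqrtr ?(ltW x0) //; have -> : (2 * K) ^+ 2 = 4 * K ^+ 2 by ring.
apply: le_trans (ler_wpM2l (ltW K0) lnx) _.
by rewrite -[leRHS](sqr_sqrtr (ltW x0)) expr2 mulrCA mulrA ler_wpM2r // ltW.
Qed.

(** Rounding the binary logarithm up costs at most 1, absorbed by [ln n >= 1]. *)
Lemma up_log2_ln {R : realType} (n : nat) : (0 < n)%N -> 1 <= ln (n%:R : R) ->
  exists r, [/\ (0 < r)%N, (n <= 2 ^ r)%N & r%:R <= (1 + (ln 2)^-1) * ln (n%:R : R)].
Proof.
move=> n0 ln1; exists (trunc_log 2 n).+1; split=> //.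
  exact/ltnW/trunc_log_ltn.
have ln2 : 0 < ln 2 :> R by rewrite ln_gt0 // ltr1n.
rewrite -natr1 addrC mulrDl mul1r lerD // mulrC ler_pdivlMr //.
rewrite mulr_natl -lnXn // ler_ln ?posrE ?exprn_gt0 ?ltr0n // -natrX ler_nat.
exact: trunc_logP.
Qed.

Local Open Scope classical_set_scope.
Local Open Scope ring_scope.

Theorem theorem1p3 (R : realType) (D : R) (hD : 0 < D) :
  exists K : R,
    forall (k : nat -> nat) (v : forall n : nat, 'I_(n %/ k n) -> 'I_n),
      (exists N : nat, forall n : nat, (N <= n)%N ->
          [/\ (0 < k n)%N, (k n)%:R < D * ln (n%:R : R), (k n %| n)%N
            & injective (v n)]) ->
      (fun n : nat =>
         Gnp_prob (K * ln (n%:R : R) / n%:R)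
           (fun E => has_path_cover_b (k n) (v n) E)) @ \oo --> (1 : R).
Proof.
(* With [L = ln n] and [r <= (1 + 1 / ln 2) * ln n] rounds, [L + 16 * r] is at most [c * ln n]; the
   factor [8 * e] of [K] comes from the spread constant. *)
pose c : R := 1 + 16 * (1 + (ln 2)^-1).
pose K := c * (8 * expR 1).
have c0 : 0 < c.
  by rewrite addr_gt0 // mulr_gt0 // addr_gt0 // invr_gt0 ln_gt0 // ltr1n.
have K0 : 0 < K by rewrite mulr_gt0 // mulr_gt0 // expR_gt0.
exists K => k v [N hN]; apply/cvgrPdist_le => eps eps0.
have [m m0 hm] : exists2 m, (0 < m)%N & 2^-1 ^+ m <= eps / 2.
  have : (fun m => 2^-1 ^+ m : R) @ \oo --> 0.
    by apply: cvg_expr; rewrite ger0_norm ?invr_ge0 // invf_lt1 // ltr1n.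
  move/cvgrPdist_le => /(_ (eps / 2)) []; first by rewrite divr_gt0.
  move=> M _ hM; exists M.+1 => //; have := hM M.+1 (leqnSn M).
  by rewrite /= sub0r normrN ger0_norm // exprn_ge0 // invr_ge0.
(* Beyond [C], [ln n] is at least 1 and [m], and the error [e * m / ln n] is at most [eps / 2]. *)
pose C := Num.max (Num.max 1 m%:R) (expR 1 * m%:R / (eps / 2)).
near=> n.
have nN : (N <= n)%N by near: n; exact: nbhs_infty_ge.
have [k0 _ kn v_inj] := hN n nN.
have n0 : (0 < n)%N by near: n; exact: nbhs_infty_gt.
have n0R : 0 < n%:R :> R by rewrite ltr0n.
have nC : C <= ln (n%:R : R).
  have : expR C <= n%:R by near: n; exact: nbhs_infty_ger.
  by rewrite -[X in _ -> _ X]ler_expR lnK.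
have [ln1 lnm lne] : [/\ 1 <= ln (n%:R : R), m%:R <= ln (n%:R : R) &
    expR 1 * m%:R / (eps / 2) <= ln (n%:R : R)].
  by move: nC; rewrite !ge_max => /andP[/andP[-> ->] ->].
have lnp : 0 < ln (n%:R : R) := lt_le_trans ltr01 ln1.
have nK : K * ln (n%:R : R) <= n%:R.
  by apply: mul_ln_le => //; near: n; exact: nbhs_infty_ger.
have p01 : 0 <= K * ln (n%:R : R) / n%:R <= 1.
  apply/andP; split; last by rewrite ler_pdivrMr // mul1r.
  by rewrite divr_ge0 // mulr_ge0 // ltW.
have [r [r0 nr rln]] := up_log2_ln n n0 ln1.
have ge : 1 - (expR 1 * m%:R / ln (n%:R : R) + 2^-1 ^+ m) <=
    Gnp_prob (K * ln (n%:R : R) / n%:R) (has_path_cover_b (k n) (v n)).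
  apply: (Gnp_path_cover_ge n (k n) m r) => //.
  case/andP: p01 => _ ->; rewrite andbT [leRHS]mulrAC /K.
  have -> : c * (8 * expR 1) / n%:R * ln (n%:R : R) =
      c * ln (n%:R : R) * (8 * expR 1 / n%:R) by ring.
  rewrite ler_wpM2r //.
  by rewrite /c [leRHS]mulrDl mul1r lerD2l -mulrA ler_wpM2l.
have em : expR 1 * m%:R / ln (n%:R : R) <= eps / 2.
  by rewrite ler_pdivrMr // [leRHS]mulrC -ler_pdivrMr // divr_gt0.
rewrite ger0_norm; first lra.
by rewrite subr_ge0; exact: Gnp_prob_le1.
Unshelve. all: by end_near.
Qed.
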